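(* Let $n$ be a nonnegative integer. The sequence of signless Bessel numbers of the first kind $\{a(n,k)\}_{k\ge 0}$ is log-concave: $$a(n,k-1)\cdot a(n,k+1)\le a(n,k)^2\qquad\text{for all integers } k\ge 1.$$
   Context: The $n$th Bessel polynomial is $y_n(x)=\sum_{k=0}^{n}\dfrac{(n+k)!}{2^k\,k!\,(n-k)!}\,x^k$, the polynomial solution of $x^2y_n''+(2x+2)y_n'=n(n+1)y_n$ with $y_n(0)=1$. For $n\ge 1$ and $k\ge 0$, the signless Bessel number of the first kind $a(n,k)$ is the coefficient of $x^{n-k}$ in $y_{n-1}(x)$ (taken to be $0$ if $k>n$). Explicitly, for $n\ge1$: $a(n,k)=\dfrac{(2n-k-1)!}{2^{n-k}(n-k)!(k-1)!}$ if $1\le k\le n$, and $a(n,k)=0$ if $k=0$ or $k>n$. By convention $a(0,k)=\delta_{0,k}$ (Kronecker delta). *)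

(* Defs.v *)
(* Bessel polynomials and signless Bessel numbers of the first kind, in the
   Mathematical Components library. *)
From HB Require Import structures.
From mathcomp Require Import all_boot all_order all_algebra.

Set Implicit Arguments.
Unset Strict Implicit.
Unset Printing Implicit Defensive.

Import Order.TTheory GRing.Theory Num.Theory.
Local Open Scope ring_scope.

Definition bessel_poly (n : nat) : {poly rat} :=
  \poly_(k < n.+1) ((n + k)`!%:R / (2 ^+ k * k`!%:R * (n - k)`!%:R)).

(* The test k <= n is needed because n - k is truncated subtraction on nat. *)
Definition bessel_number (n k : nat) : rat :=
  if n is m.+1 then (if (k <= n)%N then (bessel_poly m)`_(n - k) else 0)
  else (k == 0%N)%:R.

Lemma bessel_numberE (n k : nat) : (0 < k <= n)%N ->
  bessel_number n k =
    (2 * n - k - 1)`!%:R / (2 ^+ (n - k) * (n - k)`!%:R * (k - 1)`!%:R).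
Proof.
case: n => [|m] /andP[k_gt0 le_kn]; first by rewrite leqNgt k_gt0 in le_kn.
case: k k_gt0 le_kn => // k _ le_km.
rewrite /bessel_number le_km coef_poly !subSS ltnS leq_subr subn0 subKn //.
suff -> : (2 * m.+1 - k.+1 - 1 = m + (m - k))%N by [].
by rewrite addnBA // addnn -mul2n mulnS -subnDA addn1 !subSS.
Qed.

Lemma bessel_number0 (n : nat) : bessel_number n.+1 0 = 0.
Proof. by rewrite /bessel_number subn0 coef_poly ltnn. Qed.

(* Main.v *)
(* The ratio of consecutive terms is
   a(n,k+1) / a(n,k) = 2 (n-k) / ((2n-k-1) k),
   so with d = n - k the claim for 2 <= k < n reduces to
   (d+n) (k-1) d <= (d+1) (d+n-1) k, which holds since
   (d+1) (d+n-1) - (d+n) d = n - 1 >= 0. *)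
Require Import Defs.
From HB Require Import structures.
From mathcomp Require Import all_boot all_order all_algebra.
From mathcomp Require Import zify ring.

Set Implicit Arguments.
Unset Strict Implicit.
Unset Printing Implicit Defensive.

Import Order.TTheory GRing.Theory Num.Theory.
Local Open Scope ring_scope.

Lemma bessel_number_gt n k : (n < k)%N -> bessel_number n k = 0.
Proof.
case: n => [|n] lt_nk; first by case: k lt_nk.
by rewrite /bessel_number leqNgt lt_nk.
Qed.

(* The recurrence (2n-k-1) k a(n,k+1) = 2 (n-k) a(n,k) at k = j+1, n = k+d+1. *)
Lemma bessel_number_step (j d : nat) :
  (2 * d + j + 2)%:R * j.+1%:R * bessel_number (j + d).+2 j.+2 =
    2 * d.+1%:R * bessel_number (j + d).+2 j.+1.
Proof.
set n := (j + d).+2; rewrite !bessel_numberE; [|lia..].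
(* Both large factorials go through [2 * d + j + 1], so that [factS] leaves common factorials for
   [field] to cancel. *)
have -> : (2 * n - j.+2 - 1 = 2 * d + j + 1)%N by lia.
have -> : (2 * n - j.+1 - 1 = (2 * d + j + 1).+1)%N by lia.
have -> : (n - j.+2 = d)%N by lia.
have -> : (n - j.+1 = d.+1)%N by lia.
rewrite !subSS !subn0 !factS !natrM exprS -addnS.
have fact_neq0 i : i`!%:R != 0 :> rat by rewrite pnatr_eq0 -lt0n fact_gt0.
have exp_neq0 : 2 ^+ d != 0 :> rat by rewrite expf_neq0.
field.
by rewrite !fact_neq0 exp_neq0 !nat1r !pnatr_eq0.
Qed.

Theorem theorem4p2 (n k : nat) (hk : (1 <= k)%N) :
  bessel_number n (k - 1) * bessel_number n (k + 1) <= bessel_number n k ^+ 2.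
Proof.
have [lt_nk|le_kn] := ltnP n (k + 1).
  by rewrite (bessel_number_gt lt_nk) mulr0 sqr_ge0.
case: k hk le_kn => [//|[_|j _ le_jn]].
  (* For k = 1, the bound k + 1 <= n excludes n = 0, where a(0,0) = 1. *)
  by case: n => // n _; rewrite bessel_number0 mul0r sqr_ge0.
(* Now k = [j.+2], and [d] is n - k - 1, one less than the d = n - k used above. *)
have [d ->] : exists d, n = (j + d).+3 by exists (n - j.+3)%N; lia.
have := bessel_number_step j d.+1; have := bessel_number_step j.+1 d.
rewrite (addnS j d) (addSn j d) addn1 subn1 succnK.
move: (bessel_number _ j.+3) (bessel_number _ j.+2) (bessel_number _ j.+1).
move=> z y x step_yz step_xy.
(* The product of the two recurrences, divided by 4, relates [x * z] to [y ^+ 2] with these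
   coefficients. *)
pose c : rat := d.+2%:R * ((2 * d + j.+1 + 2)%:R * j.+2%:R).
pose c' : rat := (2 * d.+1 + j + 2)%:R * j.+1%:R * d.+1%:R.
have c_gt0 : 0 < c by rewrite /c -!natrM ltr0n; lia.
(* This is (d+n) (k-1) d <= (d+1) (d+n-1) k with d = n - k. *)
have le_c'c : c' <= c by rewrite /c /c' -!natrM ler_nat; nia.
have eq_xz : c * (x * z) = c' * y ^+ 2.
  suff : 2 * (c * (x * z)) = 2 * (c' * y ^+ 2) by apply: mulfI.
  transitivity (2 * d.+2%:R * x * ((2 * d + j.+1 + 2)%:R * j.+2%:R * z)).
    by rewrite /c; ring.
  by rewrite -step_xy step_yz /c'; ring.
rewrite -(ler_pM2l c_gt0) eq_xz.
exact: ler_wpM2r (sqr_ge0 y) _ _ le_c'c.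
Qed.
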